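(* Let $\mathbb{K}=(G,M,I)$ be a formal context and $m\in M$ with $R:=m^{(I)}\neq\emptyset$. Let $\mathcal{S}$ be a complete system of $R$-mixed generators in $\mathbb{K}$, let $g\in R$, and let $\mathbb{L}=\mathrm{op}^{g,m}(\mathbb{K})=(G,M,J)$. Define the classes $\mathcal{N},\mathcal{A},\mathcal{B},\mathcal{C},\mathcal{C}^{\neg R},\mathcal{A}_2,\mathcal{A}^{\chi=R}$ and the function $\overline{\chi}$ as in the context. Then the mappings $\alpha:S\mapsto S$ and $\beta:S\mapsto S\cup\{g\}$ are injections, respectively, from $\mathcal{A}\cup\mathcal{B}$ and from $\mathcal{A}_2\cup\mathcal{A}^{\chi=R}\cup\mathcal{B}$ into the set of all $R$-mixed generators of $\mathbb{L}$. Their images are disjoint and their union is a representative system of $R$-mixed generators in $\mathbb{L}$. The corresponding intents are: $\alpha(S)^J=S^I$ for $S\in\mathcal{A}$; $\beta(S)^J=S^I$ for $S\in\mathcal{B}$; $\alpha(S)^J=S^I\cup\{m\}$ for $S\in\mathcal{B}$; and $\beta(S)^J=S^I\setminus\{m\}$ for $S\in\mathcal{A}_2\cup\mathcal{A}^{\chi=R}$. Moreover, $\alpha(S)^J$ is an intent of $\mathbb{K}$ if and only if $S\in\mathcal{A}$, and $\beta(S)^J$ is an intent of $\mathbb{K}$ if and only if $S\notin\mathcal{A}^{\chi=R}$. The corresponding extents are $\alpha(S)^{JJ}=S\cup(\overline{\chi}(S)\setminus\{g\})$ and $\beta(S)^{JJ}=S\cup\overline{\chi}(S)\cup\{g\}$.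 In particular, if $\mathcal{S}$ is finite, then $|\mathfrak{B}(\mathbb{L})|\geq|\mathfrak{B}(\mathbb{K})|+|\mathcal{B}|-|\mathcal{C}^{\neg R}|$.
   Context: A formal context is $(G,M,I)$ with $I\subseteq G\times M$. For $A\subseteq G$, $A^I=\{n\in M:(a,n)\in I\ \forall a\in A\}$; for $B\subseteq M$, $B^I=\{h\in G:(h,n)\in I\ \forall n\in B\}$; the same notation is used for other incidence relations (e.g. $J$). Extents are sets $A\subseteq G$ with $A^{II}=A$, intents are sets $B\subseteq M$ with $B^{II}=B$; $\mathfrak{B}(\mathbb{K})$ is the set of formal concepts. For $n\in M$, $n^{(I)}:=G\setminus n^I$; for $h\in G$, $h^{(I)}:=M\setminus h^I$. For $(g,m)\notin I$, $\mathrm{op}^{g,m}(\mathbb{K})=(G,M,J)$ with $J=I\cup\{(g,n):n\in M\setminus\{m\}\}\cup\{(h,m):h\in G\setminus\{g\}\}$. For $R\subseteq G$, a set $S\subseteq G$ is an $R$-mixed generator in $(G,M,I)$ if for every $h\in G$: (i) if $h\in S\cap R$ then $(S\setminus\{h\})^{II}\neq S^{II}$; (ii) if $h\notin S\cup R$ then $(S\cup\{h\})^{II}\neq S^{II}$. ''$R$-mixed generator in $\mathbb{L}$'' means the same with $J$ in place of $I$ and the same set $R$. A representative system of $R$-mixed generators is a family of $R$-mixed generators on which $S\mapsto S^{II}$ is injective into the extents; it is complete if this map is moreover onto the set of all extents. For $S\subseteq G$ and $h\in G$, $S$ strongly avoids $h$ if $S^I\cap(h^{(I)}\setminus\{m\})\neq\emptyset$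 (always computed with $I$); $\chi(S)=\{h\in R: S\text{ strongly avoids }h\}$ and $\overline{\chi}(S)=R\setminus\chi(S)$. Classes: $\mathcal{N}=\{S\in\mathcal{S}: S\text{ is not an }R\text{-mixed generator in }\mathbb{L}\}$; $\mathcal{A}=\{S\in\mathcal{S}\setminus\mathcal{N}:S^J=S^I\}$; $\mathcal{B}=\{S\in\mathcal{S}\setminus\mathcal{N}:S^J\neq S^I,\ (S\cup\{g\})^J=S^I\}$; $\mathcal{C}=\{S\in\mathcal{S}\setminus\mathcal{N}:S^J\neq S^I,\ (S\cup\{g\})^J\neq S^I\}$; $\mathcal{C}^R=\{S\in\mathcal{C}:R\subseteq S\}$, $\mathcal{C}^{\neg R}=\{S\in\mathcal{C}:R\not\subseteq S\}$. With $\mathrm{res}(S)=S\setminus R$: $\mathcal{A}_2=\mathrm{res}(\mathcal{N})=\{S\setminus R:S\in\mathcal{N}\}$, $\mathcal{A}^{\chi=R}=\{S\in\mathcal{A}:\chi(S)=R\}$. *)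

(* Defs.v *)
(* MathComp-Analysis classical sets. A formal context (G, M, I) is a pair of
   types G, M, of any cardinality, with an incidence relation I, a subset of
   G * M. *)
From mathcomp Require Import all_boot all_order all_algebra finmap.
From mathcomp Require Import all_classical.

Set Implicit Arguments.
Unset Strict Implicit.
Unset Printing Implicit Defensive.

Local Open Scope classical_set_scope.

Section FormalContext.
Variables G M : Type.
Implicit Types (I J : set (G * M)) (A S R : set G) (B : set M) (F : set (set G)).

(* [derG I A] is A^I for A a set of objects, [derM I B] is B^I for B a set of
   attributes. *)
Definition derG I A : set M := [set n | forall a, A a -> I (a, n)].
Definition derM I B : set G := [set h | forall n, B n -> I (h, n)].

Definition cl I A : set G := derM I (derG I A).

Definition extents I : set (set G) := [set A | cl I A = A].
Definition intents I : set (set M) := [set B | derG I (derM I B) = B].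
Definition concepts I : set (set G * set M) :=
  [set AB | derG I AB.1 = AB.2 /\ derM I AB.2 = AB.1].

(* n^(I) = G \ n^I and h^(I) = M \ h^I *)
Definition nonobj I (n : M) : set G := ~` derM I [set n].
Definition nonatt I (h : G) : set M := ~` derG I [set h].

Definition op (g : G) (m : M) I : set (G * M) :=
  I `|` [set (g, n) | n in [set~ m]] `|` [set (h, m) | h in [set~ g]].

Definition mixed_generators I R : set (set G) :=
  [set S | forall h,
     (S h /\ R h -> cl I (S `\ h) <> cl I S) /\
     (~ (S `|` R) h -> cl I (S `|` [set h]) <> cl I S)].

Definition representative_system I R F : Prop :=
  [/\ F `<=` mixed_generators I R, set_fun F (extents I) (cl I)
    & set_inj F (cl I)].

Definition complete_system I R F : Prop :=
  representative_system I R F /\ set_surj F (extents I) (cl I).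

Definition strongly_avoids I (m : M) S (h : G) : Prop :=
  derG I S `&` (nonatt I h `\ m) !=set0.

(* chi(S) and its complement in R = m^(I) *)
Definition chi I (m : M) S : set G :=
  [set h | nonobj I m h /\ strongly_avoids I m S h].
Definition chibar I (m : M) S : set G := nonobj I m `\` chi I m S.

(* In the classes below, F is the given system of R-mixed generators of
   (G, M, I) and J is the incidence relation of the modified context. *)
Definition clsN J R F : set (set G) := [set S | F S /\ ~ mixed_generators J R S].

Definition clsA I J R F : set (set G) :=
  [set S | (F `\` clsN J R F) S /\ derG J S = derG I S].

Definition clsB I J R (g : G) F : set (set G) :=
  [set S | [/\ (F `\` clsN J R F) S, derG J S <> derG I S
             & derG J (S `|` [set g]) = derG I S]].

Definition clsC I J R (g : G) F : set (set G) :=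
  [set S | [/\ (F `\` clsN J R F) S, derG J S <> derG I S
             & derG J (S `|` [set g]) <> derG I S]].

Definition clsCnR I J R (g : G) F : set (set G) :=
  [set S | clsC I J R g F S /\ ~ (R `<=` S)].

Definition clsA2 J R F : set (set G) := [set S `\` R | S in clsN J R F].

Definition clsAchi I J (m : M) R F : set (set G) :=
  [set S | clsA I J R F S /\ chi I m S = R].

End FormalContext.

(* The number of elements of a finite set; only meaningful when
   [finite_set X] holds (it is 0 otherwise). *)
Definition ncard (T : choiceType) (X : set T) : nat := (#|` fset_set X|)%fset.

(* Main.v *)
(* If [g] is not in [S], then [S^J = S^I + m] and [(S + g)^J = S^I \ m].
   Comparing these with irredundancy inside [R = m^(I)] gives a description of
   the classes: [S] in [N] meets [R] in a single [h <> g], with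
   [S^I = (S \ R)^I \ m]; [S] in [A] is disjoint from [R] or meets it in [g];
   [S] in [B] meets [R] but omits [g]. So [A], [B], [N] contribute exactly their
   old intents to the new context, and every [S^I + m] for [S] in [B] and every
   [S^I \ m] for [S] in [A^(chi=R)] is a new one. For the count, the members of
   [C] containing [R] inject into [A^(chi=R)] by [S |-> S \ R]. *)
Require Import Defs.
From mathcomp Require Import all_boot all_order all_algebra finmap.
From mathcomp Require Import all_classical.
From mathcomp Require Import zify.

Local Open Scope classical_set_scope.

Set Implicit Arguments.
Unset Strict Implicit.
Unset Printing Implicit Defensive.

(** * Derivation operators and a working form of mixed generators *)

Section GaloisConnection.
Variables (G M : Type) (I : set (G * M)).
Implicit Types (S T R : set G) (X : set M).

Lemma derG_anti S T : S `<=` T -> derG I T `<=` derG I S.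
Proof. by move=> ST n Tn a /ST; apply: Tn. Qed.

Lemma sub_cl S : S `<=` cl I S.
Proof. by move=> a Sa n; apply. Qed.

Lemma derG_cl S : derG I (cl I S) = derG I S.
Proof.
apply/seteqP; split; first exact/derG_anti/sub_cl.
by move=> n Sn a; apply.
Qed.

Lemma cl_eqP S T : cl I S = cl I T <-> derG I S = derG I T.
Proof.
split=> [E|]; last by rewrite /cl => ->.
by rewrite -(derG_cl S) E derG_cl.
Qed.

Lemma cl_extent S : extents I (cl I S).
Proof. by apply/cl_eqP; rewrite derG_cl. Qed.

Lemma derG_intent S : intents I (derG I S).
Proof. exact: derG_cl. Qed.

(** Equal closures mean equal derivations. So irredundancy at [h] is witnessed by an attribute of
    [S \ h] that [h] lacks, and condition (ii) says that the closure adds only objects of [R]. *)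
Lemma mixed_generatorsP R S : mixed_generators I R S <->
  (forall h, S h -> R h -> exists2 n, derG I (S `\ h) n & ~ I (h, n)) /\
  (forall h, cl I S h -> ~ R h -> S h).
Proof.
split=> [mS|[irr closed] h].
- split=> h.
  + move=> Sh Rh; apply: contrapT => nE; apply: ((mS h).1 (conj Sh Rh)).
    apply/cl_eqP/seteqP; split; last by apply: derG_anti => a [].
    move=> n Sn a Sa; have [->|ah] := pselect (a = h); last by apply: Sn.
    by apply: contrapT => hn; apply: nE; exists n.
  + move=> clh Rh; apply: contrapT => Sh.
    have nSR : ~ (S `|` R) h by case.
    apply: (mS h).2 nSR _; apply/cl_eqP/seteqP; split.
      by apply: derG_anti => a; left.
    by move=> n Sn a [/Sn//|->]; apply: clh.
- split=> [[Sh Rh] /cl_eqP E|nSR /cl_eqP E].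
  + have [n Sn] := irr h Sh Rh; apply.
    by rewrite E in Sn; apply: Sn.
  + apply: (nSR); left; apply: closed => [n|Rh]; last by apply: nSR; right.
    by rewrite -E; apply; right.
Qed.

Lemma concepts_derG : concepts I = [set (A, derG I A) | A in extents I].
Proof.
apply/seteqP; split=> [[A B] [/= <- E]|_ [A EA <-]]; first by exists A.
by split.
Qed.

End GaloisConnection.

(** * Derivations in the modified context *)

Section Op.
Variables (G M : Type) (I : set (G * M)) (m : M) (g : G).
Hypothesis gm : ~ I (g, m).
Implicit Types (S T : set G) (X : set M).
Local Notation R := (nonobj I m).
Local Notation J := (op g m I).

Lemma nonobjP h : R h <-> ~ I (h, m).
Proof. by split=> [Rh Ihm|Ihm Rh]; [apply: Rh => n ->|apply: Ihm; apply: Rh]. Qed.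

Lemma opP h n :
  J (h, n) <-> [\/ I (h, n), h = g /\ n <> m | h <> g /\ n = m].
Proof.
split=> [[[?|[n' nm [<- <-]]]|[h' hg [<- <-]]]|[?|[-> nm]|[hg ->]]].
- exact: Or31.
- exact: Or32.
- exact: Or33.
- by left; left.
- by left; right; exists n.
- by right; exists h.
Qed.

Lemma op_inP h n : h <> g -> n <> m -> J (h, n) -> I (h, n).
Proof. by move=> hg nm /opP[//|[]|[]]. Qed.

Lemma op_gm : ~ J (g, m).
Proof. by move/opP => [//|[]|[]]. Qed.

Lemma sub_op h n : I (h, n) -> J (h, n).
Proof. by left; left. Qed.

(** In [J] the column of [m] is full except at [g]. Off that column, only the row of [g] has
    changed. *)
Lemma derG_op_out S : ~ S g -> derG J S = derG I S `|` [set m].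
Proof.
move=> Sg; apply/seteqP; split=> n.
  move=> Sn; have [->|nm] := pselect (n = m); [by right|left => a Sa].
  by apply: op_inP nm (Sn a Sa) => ag; apply: Sg; rewrite -ag.
move=> [Sn a /Sn|-> a Sa]; first exact: sub_op.
by apply/opP/Or33; split=> // ag; apply: Sg; rewrite -ag.
Qed.

(** The row of [g] in [J] is full except at [m], so [g] excludes [m] and imposes nothing else. *)
Lemma derG_op_in S : S g -> derG J S = derG I (S `\ g) `\ m.
Proof.
move=> Sg; apply/seteqP; split=> n.
  move=> Sn; have nm : n <> m by move=> nm; have := Sn g Sg; rewrite nm => /op_gm.
  by split=> // a [Sa ag]; apply: op_inP ag nm (Sn a Sa).
move=> [Sn nm] a Sa; have [->|ag] := pselect (a = g); first exact/opP/Or32.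
by apply: sub_op; apply: Sn.
Qed.

Lemma setU1DK S : ~ S g -> (S `|` [set g]) `\ g = S.
Proof.
move=> Sg; apply/seteqP; split=> a; first by case=> -[].
by move=> Sa; split; [left|move=> ag; apply: Sg; rewrite -ag].
Qed.

Lemma derG_op_add S : ~ S g -> derG J (S `|` [set g]) = derG I S `\ m.
Proof. by move=> Sg; rewrite derG_op_in ?setU1DK//; right. Qed.

Lemma derM_op_in X : X m -> derM J X = derM I (X `\ m) `\ g.
Proof.
move=> Xm; apply/seteqP; split=> h.
  move=> Xh; have hg : h <> g by move=> hg; have := Xh m Xm; rewrite hg => /op_gm.
  by split=> // n [Xn nm]; apply: op_inP hg nm (Xh n Xn).
move=> [Xh hg] n Xn; have [->|nm] := pselect (n = m); first exact/opP/Or33.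
by apply: sub_op; apply: Xh.
Qed.

Lemma derM_op_out X : ~ X m -> derM J X = derM I X `|` [set g].
Proof.
move=> Xm; apply/seteqP; split=> h.
  move=> Xh; have [->|hg] := pselect (h = g); [by right|left => n Xn].
  by apply: op_inP hg _ (Xh n Xn) => nm; apply: Xm; rewrite -nm.
move=> [Xh n /Xh|-> n Xn]; first exact: sub_op.
by apply/opP/Or32; split=> // nm; apply: Xm; rewrite -nm.
Qed.

(** Having [m] forces [h <> g], and the row of such an [h] is the same in both contexts. *)
Lemma cl_op_out S h : cl J S h -> I (h, m) -> cl I S h.
Proof.
move=> Sh hm n Sn; have [->//|nm] := pselect (n = m).
apply: op_inP nm (Sh n _) => [hg|a /Sn]; last exact: sub_op.
by apply: gm; rewrite -hg.
Qed.

Lemma chibarP S h : chibar I m S h <->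
  R h /\ (forall n, derG I S n -> n <> m -> I (h, n)).
Proof.
split=> [[Rh nchi]|[Rh Sh]]; split=> //.
  move=> n Sn nm; apply: contrapT => hn; apply: nchi; split=> //; exists n.
  by split=> //; split=> //; apply: contra_not hn; apply.
by case=> _ [n [Sn [hn nm]]]; apply: hn => _ ->; apply: Sh.
Qed.

(** Objects outside [R] have [m] anyway, so dropping [m] lets in none of them beyond the closure; on
    [R] the remaining condition is that of [chibarP]. All extent formulas come from here. *)
Lemma derM_setD1 S : (forall h, cl I S h -> ~ R h -> S h) ->
  derM I (derG I S `\ m) = S `|` chibar I m S.
Proof.
move=> closed; apply/seteqP; split=> h.
  move=> Sh; have [Rh|Rh] := pselect (R h).
    by right; apply/chibarP; split=> // n Sn nm; apply: Sh.
  left; apply: closed => // n Sn; have [->|nm] := pselect (n = m).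
    by apply: contrapT => /nonobjP.
  by apply: Sh.
by move=> [Sh n [Sn _]|/chibarP[_ Sh] n [/Sh]]; [apply: Sn|apply].
Qed.

(** Closedness outside [R] survives by [cl_op_out], so irredundancy must fail at some [h] in [R].
    This [h] is not [g], which [m] always separates in [J]. *)
Lemma mixed_generators_lostP S :
  mixed_generators I R S -> ~ mixed_generators J R S ->
  exists h, [/\ R h, S h, ~ S g, forall x, S x -> R x -> x = h
    & derG I S = derG I (S `\` R) `\ m].
Proof.
move=> mI mJ.
have /mixed_generatorsP [irr closed] := mI.
have [h [Sh Rh hJ]] : exists h,
    [/\ S h, R h & forall n, derG J (S `\ h) n -> J (h, n)].
  apply: contrapT => nE; apply: mJ; apply/mixed_generatorsP; split=> h.
    move=> Sh Rh; apply: contrapT => nn; apply: nE; exists h; split=> // n Sn.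
    by apply: contrapT => hn; apply: nn; exists n.
  move=> Sh Rh; apply: closed => //; apply: cl_op_out => //.
  by apply: contrapT => /nonobjP.
have hg : h <> g.
  move=> hg; have : J (h, m); last by rewrite hg => /op_gm.
  by apply: hJ => a [_ ah]; apply/opP/Or33; rewrite -hg.
have [n0 Sn0 hn0] := irr h Sh Rh.
(* Off [m], the row of [h] is unchanged, so any other separating attribute would still separate in
   [J]. As [m] separates, all of [S \ h] has [m], whence [h] is the only object of [S] in [R]. *)
have n0m : n0 = m.
  apply: contrapT => nm; apply: hn0; apply: op_inP hg nm (hJ _ _) => a /Sn0.
  exact: sub_op.
subst n0.
have uniq x : S x -> R x -> x = h.
  by move=> Sx /nonobjP Rx; apply: contrapT => xh; apply: Rx; apply: Sn0.
exists h; split=> //.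
  by move=> Sg; apply: hg; rewrite (uniq g)//; apply/nonobjP.
apply/seteqP; split=> n.
  move=> Sn; split; first by apply: derG_anti Sn => a [].
  by move=> nm; apply: hn0; rewrite -nm; apply: Sn.
move=> [Sn nm] a Sa; have [Ra|Ra] := pselect (R a); last exact: Sn.
rewrite (uniq a Sa Ra); apply: op_inP hg nm (hJ _ _) => b [Sb bh].
by apply: sub_op; apply: Sn; split=> // /(uniq b Sb).
Qed.

(** * The classes of a representative system *)

Section System.
Variables (F : set (set G)).
Hypothesis hF : representative_system I R F.
Local Notation N := (clsN J R F).
Local Notation A := (clsA I J R F).
Local Notation B := (clsB I J R g F).
Local Notation C := (clsC I J R g F).
Local Notation A2 := (clsA2 J R F).
Local Notation Achi := (clsAchi I J m R F).

Let Rg : R g. Proof. exact/nonobjP. Qed.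

Lemma system_mixed S : F S -> mixed_generators I R S.
Proof. by case: hF => + _ _ => /[apply]. Qed.

Lemma system_closed S h : F S -> cl I S h -> ~ R h -> S h.
Proof. by move=> /system_mixed/mixed_generatorsP[_]; apply. Qed.

Lemma system_sep S h : F S -> S h -> R h ->
  exists2 n, derG I (S `\ h) n & ~ I (h, n).
Proof. by move=> /system_mixed/mixed_generatorsP[+ _]; apply. Qed.

Lemma system_inj S T : F S -> F T -> derG I S = derG I T -> S = T.
Proof.
by case: hF => _ _ inj FS FT E; apply: inj; rewrite ?inE//; apply/cl_eqP.
Qed.

Lemma clsNP S : N S -> exists h, [/\ R h, S h, ~ S g,
  forall x, S x -> R x -> x = h & derG I S = derG I (S `\` R) `\ m].
Proof. by case=> FS; apply: mixed_generators_lostP; apply: system_mixed. Qed.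

Lemma notN_mixed S : (F `\` N) S -> mixed_generators J R S.
Proof. by case=> FS nN; apply: contrapT => nJ; apply: nN. Qed.

Lemma clsAP S : A S -> (forall x, S x -> ~ R x) \/
  [/\ S g, forall x, S x -> R x -> x = g & derG I S = derG I (S `\ g) `\ m].
Proof.
move=> [[FS _] E]; have [Sg|Sg] := pselect (S g); last first.
  left => x Sx /nonobjP xm; apply: xm.
  suff : derG I S m by apply.
  by rewrite -E derG_op_out//; right.
right; move: E; rewrite derG_op_in// => E; split=> // x Sx /nonobjP xm.
apply: contrapT => xg; apply: (xm).
have [n Sn gn] := system_sep FS Sg Rg.
have [<-|nm] := pselect (n = m); first by apply: Sn.
by exfalso; apply: gn; have : derG I S n by [rewrite -E]; apply; exact: Sg.
Qed.

(** With [g] in [S], adding [g] changes nothing; with [S] disjoint from [R], [m] is in [S^I]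
    already. Either way [S^J = S^I]. *)
Lemma clsBP S : B S -> ~ S g /\ exists2 h, S h & R h.
Proof.
move=> [_ nE E].
have Sg : ~ S g.
  move=> Sg; apply: nE; rewrite -E; congr derG.
  by apply/seteqP; split=> [a|a [//|->//]]; left.
split=> //; apply: contrapT => nh; apply: nE.
rewrite derG_op_out//; apply/seteqP; split=> n; last by left.
case=> // -> a Sa; apply: contrapT => /nonobjP Ra; apply: nh; by exists a.
Qed.

Lemma clsB_notm S : B S -> ~ derG I S m.
Proof. by move=> /clsBP[_ [h Sh /nonobjP hm]]; apply: contra_not hm; apply. Qed.

Lemma clsAchi_avoids S h : Achi S -> R h ->
  exists n, [/\ derG I S n, n <> m & ~ I (h, n)].
Proof.
move=> [_ E] Rh; apply: contrapT => nE.
have [_] : chibar I m S h; last by rewrite E.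
apply/chibarP; split=> // n Sn nm; apply: contrapT => hn.
by apply: nE; exists n.
Qed.

(** The other case of [clsAP] puts [g] into [S], but [g] is in [R] and so lacks some attribute of
    [S^I]. *)
Lemma clsAchi_disjR S x : Achi S -> S x -> ~ R x.
Proof.
move=> AS; have [] := clsAP AS.1; first by apply.
move=> [Sg _ _]; have [n [Sn _]] := clsAchi_avoids AS Rg; case.
exact: Sn.
Qed.

Definition dombeta := A2 `|` Achi `|` B.

Lemma dombeta_g S : dombeta S -> ~ S g.
Proof.
case=> [[[T _ <-] []//|AS Sg]|/clsBP[]//].
exact: (clsAchi_disjR AS Sg).
Qed.

Lemma clsA2_disjR S x : A2 S -> S x -> ~ R x.
Proof. by case=> T _ <- []. Qed.

Lemma dombeta_closed S h : dombeta S -> cl I S h -> ~ R h -> S h.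
Proof.
case=> [[[T NT <-]|[[[FS _] _] _]]|[[FS _] _ _]]; try exact: system_closed.
move=> Th Rh; split=> //; apply: system_closed Rh; first by case: NT.
by move=> n Tn; apply: Th; apply: derG_anti Tn => a [].
Qed.

Lemma derG_beta S : dombeta S -> derG J (S `|` [set g]) = derG I S `\ m.
Proof. by move=> /dombeta_g; apply: derG_op_add. Qed.

Lemma clsA2_derG S : A2 S ->
  exists2 T, N T & derG I T = derG I S `\ m /\ S = T `\` R.
Proof. by case=> T NT <-; exists T => //; have [h [_ _ _ _]] := clsNP NT. Qed.

(** Irredundancy is taken in [J], where [h], being different from [g], has [m]; so the separating
    attribute is not [m]. *)
Lemma clsB_minimal S h : B S -> S h -> R h ->
  exists n, [/\ derG I (S `\ h) n, n <> m & ~ I (h, n)].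
Proof.
move=> BS Sh Rh; have [nN _ _] := BS; have [Sg _] := clsBP BS.
have /mixed_generatorsP[+ _] := notN_mixed nN => /(_ h Sh Rh)[n].
rewrite derG_op_out; last by case.
move=> Sn hn; have nm : n <> m.
  move=> nm; apply: hn; rewrite nm; apply/opP/Or33; split=> // hg.
  by apply: Sg; rewrite -hg.
case: Sn => // Sn; exists n; split=> //.
by apply: contra_not hn; apply: sub_op.
Qed.

(** * Mixed generators given by the two maps, with their intents and extents *)

Lemma alpha_mixed S : (A `|` B) S -> mixed_generators J R S.
Proof. by case=> [[/notN_mixed//]|[/notN_mixed]]. Qed.

(** The new object [g] is separated by [m]. Other objects of [R] occur only for [S] in [B], and
    there the attribute from [clsB_minimal] still works, since [g] has it in [J]. *)
Lemma beta_mixed S : dombeta S -> mixed_generators J R (S `|` [set g]).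
Proof.
move=> DS; have Sg := dombeta_g DS.
apply/mixed_generatorsP; split=> h; last first.
  move=> Sh Rh; left; apply: dombeta_closed => //.
  move=> n Sn; have [->|nm] := pselect (n = m).
    by apply: contrapT => /nonobjP.
  apply: (op_inP _ nm (Sh n _)) => [hg|]; first by apply: Rh; rewrite hg.
  by rewrite derG_op_add//; split.
have [-> _ _|hg [Sh|//] Rh] := pselect (h = g).
  exists m; last exact: op_gm.
  by rewrite setU1DK// derG_op_out//; right.
case: DS => [[AS|AS]|BS].
- by case: (clsA2_disjR AS Sh).
- by case: (clsAchi_disjR AS Sh).
- have [n [Sn nm hn]] := clsB_minimal BS Sh Rh.
  exists n; last by apply: contra_not hn; apply: op_inP.
  move=> a [[Sa|->] ah]; first by apply: sub_op; apply: Sn.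
  by apply/opP/Or32.
Qed.

Lemma beta_inj : set_inj dombeta (fun S => S `|` [set g]).
Proof.
move=> S T; rewrite !inE => /dombeta_g Sg /dombeta_g Tg E.
by rewrite -(setU1DK Sg) E setU1DK.
Qed.

Lemma images_disjoint : (A `|` B) `&` [set S `|` [set g] | S in dombeta] = set0.
Proof.
apply/seteqP; split=> // U [DU [T DT TU]].
have Ug : U g by rewrite -TU; right.
have Tg := dombeta_g DT.
case: DU => [AU|/clsBP[]//].
have [disj|[_ Uuniq]] := clsAP AU; first by case: (disj g Ug).
(* A common member [U] contains [g], so it lies in [A] and meets [R] only in [g]; hence [U^I] is
   [T^I] without [m]. *)
rewrite -{2}TU setU1DK// => E.
case: DT => [[A2T|AT]|BT].
- have [T' NT' [E' _]] := clsA2_derG A2T.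
  have [h [_ _ T'g _ _]] := clsNP NT'.
  apply: T'g; suff -> : T' = U by [].
  by apply: system_inj; [case: NT'|case: AU => -[]|rewrite E E'].
- have [n [Tn nm]] := clsAchi_avoids AT Rg; apply.
  by have : derG I U n by [rewrite E]; apply.
- have [_ [h Th Rh]] := clsBP BT; apply: Tg.
  by rewrite -(Uuniq h)// -TU; left.
Qed.

Lemma clsB_not_intent S : B S -> ~ intents I (derG J S).
Proof.
move=> BS; have [Sg [h Sh Rh]] := clsBP BS; rewrite derG_op_out// => XE.
have [n [Sn nm hn]] := clsB_minimal BS Sh Rh.
have : (derG I S `|` [set m]) n; last by case=> // /(_ h Sh).
(* An intent [S^I + m] is the derivation of [S \ R], which lies in [S \ h]. *)
rewrite -XE => a Xa; apply: Sn; split.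
  apply: (system_closed (S := S)); first by case: BS => -[].
    by move=> p Sp; apply: Xa; left.
  by move=> /nonobjP; apply; apply: Xa; right.
by move=> ah; case/nonobjP: Rh; rewrite -ah; apply: Xa; right.
Qed.

(** Here [chibar] is empty, so the attribute set [S^I \ m] has extent [S], and its closure [S^I]
    contains [m] again. *)
Lemma clsAchi_not_intent S : Achi S -> ~ intents I (derG J (S `|` [set g])).
Proof.
move=> AS; have DS : dombeta S by left; right.
rewrite derG_beta// => XE.
suff sub : derG I S `<=` derG I S `\ m.
  have [|_] := sub m; last exact.
  by move=> a Sa; apply: contrapT => /nonobjP; apply: clsAchi_disjR Sa.
rewrite -XE (derM_setD1 (fun h => @dombeta_closed S h DS))//.
by move=> n Sn a [/Sn//|[Ra]]; rewrite AS.2.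
Qed.

Lemma derG_beta_B S : B S -> derG J (S `|` [set g]) = derG I S.
Proof. by case. Qed.

Lemma derG_alpha_B S : B S -> derG J S = derG I S `|` [set m].
Proof. by move=> /clsBP[Sg _]; rewrite derG_op_out. Qed.

Lemma alpha_intentP S : (A `|` B) S -> intents I (derG J S) <-> A S.
Proof.
move=> DS; split=> [XE|[_ ->]]; last exact: derG_intent.
by case: DS => // /clsB_not_intent.
Qed.

Lemma beta_intentP S : dombeta S ->
  intents I (derG J (S `|` [set g])) <-> ~ Achi S.
Proof.
move=> DS; split=> [XE /clsAchi_not_intent //|nA].
case: (DS) => [[A2S|//]|BS]; last by rewrite derG_beta_B//; apply: derG_intent.
by rewrite derG_beta//; have [T _ [<- _]] := clsA2_derG A2S; apply: derG_intent.
Qed.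

Lemma cl_alpha S : (A `|` B) S -> cl J S = S `|` (chibar I m S `\ g).
Proof.
move=> DS; have FS : F S by case: DS => [[[]]|[[]]].
have closed h := system_closed (h := h) FS.
have key : ~ S g -> (S `|` chibar I m S) `\ g = S `|` (chibar I m S `\ g).
  move=> Sg; apply/seteqP; split=> h; first by case=> -[]; [left|right].
  case=> [Sh|[Sh hg]]; last by split=> //; right.
  by split; [left|move=> hg; apply: Sg; rewrite -hg].
rewrite /cl; case: DS => [AS|BS]; last first.
  have [Sg _] := clsBP BS.
  rewrite derG_alpha_B// derM_op_in; last by right.
  rewrite -key// -derM_setD1//; congr (derM I _ `\ g).
  by apply/seteqP; split=> n; [case=> -[]|case=> Sn nm; split=> //; left].
rewrite AS.2; have [disj|[Sg _ E]] := clsAP AS.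
  rewrite derM_op_in ?derM_setD1// ?key//; first by move=> /disj.
  by move=> a /disj Ra; apply: contrapT => /nonobjP.
(* In the remaining case [S] contains [g]: [m] is not in the intent, the extent gains only [g], and
   [g] is already in [S]. *)
have Sm : ~ derG I S m by rewrite E => -[_]; apply.
have -> : derG I S = derG I S `\ m.
  by apply/seteqP; split=> [n Sn|n []//]; split=> // nm; apply: Sm; rewrite -nm.
rewrite derM_op_out; last by case=> _; apply.
rewrite derM_setD1//; apply/seteqP; split=> h.
  case=> [[]|->]; [by left| |by left].
  by have [->|hg] := pselect (h = g); [left|right].
by case=> [Sh|[Sh _]]; left; [left|right].
Qed.

Lemma cl_beta S : dombeta S ->
  cl J (S `|` [set g]) = S `|` chibar I m S `|` [set g].
Proof.
move=> DS; rewrite /cl derG_beta// derM_op_out; last by case=> _; apply.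
by rewrite derM_setD1// => h; apply: dombeta_closed.
Qed.

(* The intents common to both contexts are the [S^I] with [S] in [A], [B] or
   [N]; [keep S] is the generator of the new context whose intent is [S^I]. *)
Definition keep S : set G :=
  if `[< A S >] then S else if `[< B S >] then S `|` [set g]
  else (S `\` R) `|` [set g].

(** * The union of the images is a representative system *)

Definition images := (A `|` B) `|` [set S `|` [set g] | S in dombeta].

(** Sorts the images by intent: intents of the old context, new ones containing [m], new ones
    omitting [m]. *)
Lemma imagesP U : images U ->
  [\/ exists S, [/\ F S, derG J U = derG I S & U = keep S],
      B U |
      exists2 S, Achi S & U = S `|` [set g]].
Proof.
case=> [[AU|BU]|[S DS <-]].
- apply: Or31; exists U; split; [by case: AU => -[]|by case: AU|].
  by rewrite /keep asboolT.
- exact: Or32.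
- case: (DS) => [[A2S|AS]|BS].
  + have [T NT [E ST]] := clsA2_derG A2S.
    apply: Or31; exists T; split; [by case: NT|by rewrite derG_beta|].
    by rewrite /keep !asboolF ?ST// => -[[_]].
  + by apply: Or33; exists S.
  + apply: Or31; exists S; split; [by case: BS => -[]|by case: BS|].
    by rewrite /keep asboolF ?asboolT// => -[_ E]; case: BS => _ /(_ E).
Qed.

(** Within each kind of [imagesP] the intent determines the old generator, since it is known whether
    [m] was in [S^I]. Old and new kinds differ by being an intent of [I], the two new kinds by
    [m]. *)
Lemma images_inj U V : images U -> images V -> derG J U = derG J V -> U = V.
Proof.
have Binj S T : B S -> B T -> derG J S = derG J T -> S = T.
  move=> BS BT E; apply: system_inj; [by case: BS => -[]|by case: BT => -[]|].
  move: E; rewrite !derG_alpha_B// => E; apply/seteqP; split=> n Xn.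
    have : (derG I T `|` [set m]) n by rewrite -E; left.
    by case=> // nm; case: (clsB_notm BS); rewrite -nm.
  have : (derG I S `|` [set m]) n by rewrite E; left.
  by case=> // nm; case: (clsB_notm BT); rewrite -nm.
have Ainj S T : Achi S -> Achi T ->
    derG J (S `|` [set g]) = derG J (T `|` [set g]) -> S = T.
  move=> AS AT; have DS : dombeta S by left; right.
  have DT : dombeta T by left; right.
  have Am Y : Achi Y -> derG I Y m.
    by move=> AY a Ya; apply: contrapT => /nonobjP; apply: clsAchi_disjR Ya.
  rewrite !derG_beta// => E; apply: system_inj.
  - by case: AS => -[[]].
  - by case: AT => -[[]].
  apply/seteqP; split=> n Xn.
    have [->|nm] := pselect (n = m); first exact: Am.
    by have [] : (derG I T `\ m) n by rewrite -E.
  have [->|nm] := pselect (n = m); first exact: Am.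
  by have [] : (derG I S `\ m) n by rewrite E.
have AB S T : B S -> Achi T -> derG J S <> derG J (T `|` [set g]).
  move=> BS AT; have DT : dombeta T by left; right.
  rewrite derG_alpha_B// derG_beta// => E.
  by suff [_] : (derG I T `\ m) m; [apply|rewrite -E; right].
move=> /imagesP[[S [FS ES EU]]|BU|[S AS EU]];
  move=> /imagesP[[T [FT ET EV]]|BV|[T AT EV]] E.
- by rewrite EU EV; congr keep; apply: system_inj => //; rewrite -ES -ET.
- by case: (clsB_not_intent BV); rewrite -E ES; apply: derG_intent.
- by case: (clsAchi_not_intent AT); rewrite -EV -E ES; apply: derG_intent.
- by case: (clsB_not_intent BU); rewrite E ET; apply: derG_intent.
- exact: Binj.
- by case: (AB _ _ BU AT); rewrite -EV.
- by case: (clsAchi_not_intent AS); rewrite -EU E ET; apply: derG_intent.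
- by case: (AB _ _ BV AS); rewrite -EU.
- by rewrite EU EV (Ainj S T)// -EU -EV.
Qed.

Lemma images_representative : representative_system J R images.
Proof.
split.
- by move=> U [/alpha_mixed//|[S DS <-]]; apply: beta_mixed.
- by move=> U _; apply: cl_extent.
- by move=> U V; rewrite !inE => DU DV /cl_eqP; apply: images_inj.
Qed.

(** * Injections for the count *)

Lemma clsN_res_inj : set_inj N (fun S => S `\` R).
Proof.
move=> S T; rewrite !inE => NS NT E.
have [h [_ _ _ _ ES]] := clsNP NS; have [k [_ _ _ _ ET]] := clsNP NT.
by apply: system_inj; [case: NS|case: NT|rewrite ES E ET].
Qed.

Lemma setDRK S : R `<=` S -> (S `\` R) `|` R = S.
Proof.
move=> RS; apply/seteqP; split=> h; first by case=> [[]//|/RS].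
by move=> Sh; have [|] := pselect (R h); [right|left].
Qed.

Lemma clsC_res_inj : set_inj [set S | C S /\ R `<=` S] (fun S => S `\` R).
Proof.
by move=> S T; rewrite !inE => -[_ RS] [_ RT] E; rewrite -(setDRK RS) E setDRK.
Qed.

(** Without [g], one of [S^I + m] and [S^I \ m] equals [S^I], which places [S] outside [C]. *)
Lemma clsC_g S : C S -> S g.
Proof.
move=> [_ nE nEg]; apply: contrapT => Sg; apply: nEg.
rewrite derG_op_add//; apply/seteqP; split=> n; first by case.
move=> Sn; split=> // nm; apply: nE; rewrite derG_op_out//.
by apply/seteqP; split=> k; [case=> // ->; rewrite -nm|left].
Qed.

(** The set [S \ R] is an extent, since its closure consists of objects having [m] and lies in [S].
    Completeness then gives a member [T] of the system, which must be [S \ R] itself. *)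
Lemma clsC_res_Achi (onto : set_surj F (extents I) (cl I)) S :
  C S -> R `<=` S -> Achi (S `\` R).
Proof.
move=> CS RS; have Sg := clsC_g CS; have [[FS _] nE _] := CS.
have resE : cl I (S `\` R) = S `\` R.
  apply/seteqP; split; last exact: sub_cl.
  move=> h Sh; have Rh : ~ R h.
    move=> /nonobjP; apply; apply: Sh => a [_ Ra].
    by apply: contrapT => /nonobjP.
  split=> //; apply: system_closed Rh => // n Sn.
  by apply: Sh; apply: derG_anti Sn => a [].
have [T FT TE] := onto _ resE.
have TR x : T x -> ~ R x by move=> /(@sub_cl _ _ I); rewrite TE => -[].
have {}TE : T = S `\` R.
  rewrite -TE; apply/seteqP; split; first exact: sub_cl.
  by move=> x clx; apply: system_closed => //; move: clx; rewrite TE => -[].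
rewrite -TE; have Tm : derG I T m.
  by move=> a /TR Ra; apply: contrapT => /nonobjP.
have Tg : ~ T g by move=> /TR.
split.
  split; first by split=> // /clsNP[h [Rh /TR]].
  by rewrite derG_op_out//; apply/seteqP; split=> n; [case=> // ->|left].
apply/seteqP; split=> [h []//|h Rh]; split=> //; apply: contrapT => nav.
have Th n : derG I T n -> n <> m -> I (h, n).
  by have /chibarP[_] : chibar I m T h; [split=> // -[_]|apply].
(* A second object [k] of [R] lies in [S] and lacks [m], so the attribute separating [h] in [S] is
   not [m] and shows that [T] strongly avoids [h]. If [R] is only [h = g], failure to avoid it gives
   [S^J = S^I], excluded in [C]. *)
have [[k [Rk kh]]|Rh1] := pselect (exists k, R k /\ k <> h).
  have [n Sn] := system_sep FS (RS h Rh) Rh; apply; apply: Th.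
    apply: derG_anti Sn => a; rewrite TE => -[Sa nRa].
    by split=> // ah; apply: nRa; rewrite ah.
  move=> nm; have /nonobjP := Rk; rewrite -{1}nm; apply; apply: Sn.
  by split=> //; apply: RS.
have Runiq k : R k -> k = h.
  by move=> Rk; apply: contrapT => kh; apply: Rh1; exists k.
have hg := Runiq g Rg.
apply: nE; rewrite derG_op_in//.
have -> : S `\ g = T.
  rewrite TE; apply/seteqP; split=> a [Sa].
    by move=> ag; split=> // /Runiq; rewrite -hg.
  by move=> Ra; split=> // ag; apply: Ra; rewrite ag.
apply/seteqP; split=> n.
  move=> [Tn nm] a Sa; have [Ra|Ra] := pselect (R a).
    by rewrite (Runiq a Ra); apply: Th.
  by apply: Tn; rewrite TE.
move=> Sn; split; first by apply: derG_anti Sn; rewrite TE => a [].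
by move=> nm; apply: gm; rewrite -nm; apply: Sn.
Qed.

End System.
End Op.

(** * Cardinalities of finite sets *)

Section Ncard.
Implicit Types T U : choiceType.

Lemma ncard_image T U (X : set T) (f : T -> U) :
  finite_set X -> set_inj X f -> ncard (f @` X) = ncard X.
Proof.
move=> finX injf; apply/fcard_eq => //; first exact: finite_image.
exact: inj_card_eq.
Qed.

Lemma ncard_le T (X Y : set T) :
  finite_set Y -> X `<=` Y -> (ncard X <= ncard Y)%N.
Proof.
move=> finY XY; apply: fsubset_leq_card; rewrite -fset_set_sub//.
exact: sub_finite_set finY.
Qed.

Lemma ncard_setU_le T (X Y : set T) : finite_set X -> finite_set Y ->
  (ncard (X `|` Y) <= ncard X + ncard Y)%N.
Proof. by move=> fX fY; rewrite /ncard fset_setU// leq_card_fsetU. Qed.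

Lemma ncard_setU_disjoint T (X Y : set T) : finite_set X -> finite_set Y ->
  X `&` Y = set0 -> ncard (X `|` Y) = (ncard X + ncard Y)%N.
Proof.
move=> fX fY XY; rewrite /ncard fset_setU// cardfsU -fset_setI// XY fset_set0.
by rewrite cardfs0 subn0.
Qed.

End Ncard.

(** * Counting the concepts of both contexts *)

Section Counting.
Variables (G M : Type) (I : set (G * M)) (m : M) (g : G) (F : set (set G)).
Hypotheses (gm : ~ I (g, m)) (hF : complete_system I (nonobj I m) F)
  (finF : finite_set F).
Local Notation R := (nonobj I m).
Local Notation J := (op g m I).
Local Notation N := (clsN J R F).
Local Notation A := (clsA I J R F).
Local Notation B := (clsB I J R g F).
Local Notation C := (clsC I J R g F).
Local Notation CnR := (clsCnR I J R g F).
Local Notation A2 := (clsA2 J R F).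
Local Notation Achi := (clsAchi I J m R F).

Lemma concepts_image : concepts I = [set (cl I S, derG I S) | S in F].
Proof.
rewrite concepts_derG; apply/seteqP; split=> [_ [E EE <-]|_ [S FS <-]].
  by have [S FS SE] := hF.2 _ EE; exists S => //; rewrite -SE derG_cl.
by exists (cl I S); [exact: cl_extent|rewrite derG_cl].
Qed.

Lemma finite_concepts : finite_set (concepts I).
Proof. by rewrite concepts_image; apply: finite_image. Qed.

Lemma ncard_concepts : ncard (concepts I) = ncard F.
Proof.
rewrite concepts_image ncard_image// => S T FS FT [E _].
by case: hF => -[_ _ inj] _; apply: inj.
Qed.

(** Every intent of [J] is an intent of [I] with [m] added or removed. *)
Lemma finite_concepts_op : finite_set (concepts J).
Proof.
apply: (@sub_finite_set _ _
  ([set (derM J (AX.2 `|` [set m]), AX.2 `|` [set m]) | AX in concepts I] `|`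
   [set (derM J (AX.2 `\ m), AX.2 `\ m) | AX in concepts I])); last first.
  by rewrite finite_setU; split; apply/finite_image/finite_concepts.
have conceptI S : concepts I (cl I S, derG I S) by split=> //=; apply: derG_cl.
move=> [E X] [/= <- EE]; have [Eg|Eg] := pselect (E g).
  right; exists (cl I (E `\ g), derG I (E `\ g)) => //=.
  by rewrite -(derG_op_in gm Eg) EE.
by left; exists (cl I E, derG I E) => //=; rewrite -(derG_op_out I m Eg) EE.
Qed.

Lemma finite_clsA : finite_set A.
Proof. by apply: sub_finite_set finF => S [[]]. Qed.

Lemma finite_clsB : finite_set B.
Proof. by apply: sub_finite_set finF => S [[]]. Qed.

Lemma finite_clsN : finite_set N.
Proof. by apply: sub_finite_set finF => S []. Qed.

Lemma finite_clsA2 : finite_set A2.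
Proof. exact/finite_image/finite_clsN. Qed.

Lemma finite_clsAchi : finite_set Achi.
Proof. by apply: sub_finite_set finite_clsA => S []. Qed.

Lemma finite_dombeta : finite_set (dombeta I m g F).
Proof.
rewrite !finite_setU; split; last exact: finite_clsB.
by split; [exact: finite_clsA2|exact: finite_clsAchi].
Qed.

Lemma finite_images : finite_set (images I m g F).
Proof.
rewrite !finite_setU; split; last exact/finite_image/finite_dombeta.
by split; [exact: finite_clsA|exact: finite_clsB].
Qed.

Lemma ncard_images_le : (ncard (images I m g F) <= ncard (concepts J))%N.
Proof.
have inj : set_inj (images I m g F) (fun U => (cl J U, derG J U)).
  move=> U V; rewrite !inE => DU DV [_ E].
  exact: (images_inj gm hF.1).
rewrite -(ncard_image finite_images inj); apply: ncard_le.
  exact: finite_concepts_op.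
by move=> _ [U _ <-]; split=> //=; apply: derG_cl.
Qed.

(** All unions are disjoint. [A2] and [Achi] are told apart by whether [S^I \ m] is an intent of
    [I]; both avoid [R], which members of [B] meet. [A2] has the size of [N] by [clsN_res_inj]. *)
Lemma ncard_images : ncard (images I m g F) =
  (ncard A + ncard B + (ncard N + ncard Achi + ncard B))%N.
Proof.
have disjAB : A `&` B = set0.
  by apply/seteqP; split=> // S [[_ E] [_ /(_ E)]].
have disjA2chi : A2 `&` Achi = set0.
  apply/seteqP; split=> // S [A2S AS].
  have DS : dombeta I m g F S by left; left.
  by case: ((beta_intentP gm hF.1 DS).1 _ AS);
    rewrite (derG_beta gm hF.1 DS); have [T _ [<- _]] := clsA2_derG gm hF.1 A2S;
    apply: derG_intent.
have disjB : (A2 `|` Achi) `&` B = set0.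
  apply/seteqP; split=> // S [DS BS]; have [_ [h Sh Rh]] := clsBP BS.
  case: DS => [A2S|AS]; first exact: (clsA2_disjR A2S Sh Rh).
  exact: (clsAchi_disjR gm hF.1 AS Sh Rh).
have finA2chi : finite_set (A2 `|` Achi).
  by rewrite finite_setU; split; [exact: finite_clsA2|exact: finite_clsAchi].
have [finA finB] := (finite_clsA, finite_clsB).
rewrite /images ncard_setU_disjoint.
- rewrite ncard_setU_disjoint// ncard_image.
  + rewrite /dombeta ncard_setU_disjoint// ncard_setU_disjoint//.
    * by rewrite ncard_image//; [exact: finite_clsN|exact: (clsN_res_inj gm hF.1)].
    * exact: finite_clsA2.
    * exact: finite_clsAchi.
  + exact: finite_dombeta.
  + exact: (beta_inj gm hF.1).
- by rewrite finite_setU.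
- exact/finite_image/finite_dombeta.
- exact: (images_disjoint gm hF.1).
Qed.

Lemma ncard_clsC_le : (ncard [set S | C S /\ R `<=` S] <= ncard Achi)%N.
Proof.
have finCR : finite_set [set S | C S /\ R `<=` S].
  by apply: sub_finite_set finF => S [[[]]].
rewrite -(ncard_image finCR (clsC_res_inj (g := g) (F := F))).
apply: ncard_le; first exact: finite_clsAchi.
by move=> _ [S [CS RS] <-]; apply: (clsC_res_Achi gm hF.1 hF.2 CS RS).
Qed.

Lemma ncard_system_le :
  (ncard F <= ncard A + ncard B + ncard N + ncard CnR + ncard Achi)%N.
Proof.
pose CR := [set S | C S /\ R `<=` S].
have cover : F `<=` A `|` B `|` N `|` CnR `|` CR.
  move=> S FS; have [NS|NS] := pselect (N S); first by left; left; right.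
  have [EA|EA] := pselect (derG J S = derG I S); first by do 4 left.
  have [EB|EB] := pselect (derG J (S `|` [set g]) = derG I S).
    by do 3 left; right.
  have [RS|RS] := pselect (R `<=` S); first by right.
  by left; right.
have finCnR : finite_set CnR by apply: sub_finite_set finF => S [[[]]].
have finCR : finite_set CR by apply: sub_finite_set finF => S [[[]]].
have [finA finB finN] := And3 finite_clsA finite_clsB finite_clsN.
apply: leq_trans (ncard_le _ cover) _; first by rewrite !finite_setU.
apply: leq_trans (ncard_setU_le _ finCR) _; first by rewrite !finite_setU.
apply: leq_add; last exact: ncard_clsC_le.
apply: leq_trans (ncard_setU_le _ finCnR) _; first by rewrite !finite_setU.
rewrite leq_add2r.
apply: leq_trans (ncard_setU_le _ finN) _; first by rewrite finite_setU.
by rewrite leq_add2r ncard_setU_le.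
Qed.

End Counting.

Unset Implicit Arguments.

Theorem theorem3 (G M : Type) (I : set (G * M)) (m : M)
    (hR : nonobj I m !=set0)
    (F : set (set G)) (hF : complete_system I (nonobj I m) F)
    (g : G) (hg : nonobj I m g) :
  let R := nonobj I m in
  let J := op g m I in
  let A := clsA I J R F in
  let B := clsB I J R g F in
  let CnR := clsCnR I J R g F in
  let A2 := clsA2 J R F in
  let Achi := clsAchi I J m R F in
  let domalpha := A `|` B in
  let dombeta := A2 `|` Achi `|` B in
  let alpha := fun S : set G => S in
  let beta := fun S : set G => S `|` [set g] in
  (* alpha and beta are injections into the R-mixed generators of L *)
  (set_fun domalpha (mixed_generators J R) alpha /\ set_inj domalpha alpha) /\
  (set_fun dombeta (mixed_generators J R) beta /\ set_inj dombeta beta) /\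
  (* disjoint images, whose union is a representative system *)
  (alpha @` domalpha) `&` (beta @` dombeta) = set0 /\
  representative_system J R ((alpha @` domalpha) `|` (beta @` dombeta)) /\
  (* intents *)
  (forall S, A S -> derG J (alpha S) = derG I S) /\
  (forall S, B S -> derG J (beta S) = derG I S) /\
  (forall S, B S -> derG J (alpha S) = derG I S `|` [set m]) /\
  (forall S, (A2 `|` Achi) S -> derG J (beta S) = derG I S `\ m) /\
  (forall S, domalpha S -> (intents I (derG J (alpha S)) <-> A S)) /\
  (forall S, dombeta S -> (intents I (derG J (beta S)) <-> ~ Achi S)) /\
  (* extents *)
  (forall S, domalpha S -> cl J (alpha S) = S `|` (chibar I m S `\ g)) /\
  (forall S, dombeta S -> cl J (beta S) = S `|` chibar I m S `|` [set g]) /\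
  (* number of concepts *)
  (finite_set F ->
     [/\ finite_set (concepts I), finite_set (concepts J) &
       ((ncard (concepts J))%:Z >=
          (ncard (concepts I))%:Z + (ncard B)%:Z - (ncard CnR)%:Z)%R]).
Proof.
move=> /= {hR}; have gm : ~ I (g, m) by apply/nonobjP.
have hF' := hF.1.
split; first by split; [exact: alpha_mixed|by move=> S T _ _].
split; first by split; [exact: (beta_mixed gm hF')|exact: (beta_inj gm hF')].
rewrite image_id; split; first exact: (images_disjoint gm hF').
split; first exact: (images_representative gm hF').
split; first by move=> S [].
split; first by move=> S; apply: derG_beta_B.
split; first by move=> S; apply: derG_alpha_B.
split; first by move=> S DS; apply: (derG_beta gm hF'); left.
split; first exact: (alpha_intentP hF').
split; first exact: (beta_intentP gm hF').
split; first exact: (cl_alpha gm hF').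
split; first exact: (cl_beta gm hF').
move=> finF; split.
- exact: (finite_concepts hF finF).
- exact: (finite_concepts_op gm hF finF).
(* The images number [|A| + 2|B| + |N| + |Achi|], the system at most
   [|A| + |B| + |N| + |CnR| + |Achi|]; the difference is at least [|B| - |CnR|]. *)
- have := ncard_images_le gm hF finF; have := ncard_system_le gm hF finF.
  rewrite (ncard_images gm hF finF) -(ncard_concepts hF finF).
  lia.
Qed.
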